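(* Let $\mathscr{S}$ be a fake pullback ready bicategory. There is a category $\mathrm{Spn}[\mathscr{S}]$ whose objects are those of $\mathscr{S}$, whose morphisms $X\to Y$ are isomorphism classes of spans $X\leftarrow S\rightarrow Y$ in $\mathscr{S}$, and whose composition is defined by fake pullback: the composite of the classes of $X\xleftarrow{p}S\xrightarrow{q}Y$ and $Y\xleftarrow{p'}T\xrightarrow{q'}Z$ is the class of $X\xleftarrow{p\circ u}Q\xrightarrow{q'\circ v}Z$, where $S\xleftarrow{u}Q\xrightarrow{v}T$ is a fake pullback of the cospan $S\xrightarrow{q}Y\xleftarrow{p'}T$.
   Context: A bicategory is locally preordered when every hom-category is a preorder (at most one 2-cell between parallel morphisms). Factorization system $(\mathscr{U},\mathscr{L})$ on a bicategory $\mathscr{S}$: classes of morphisms containing the equivalences, closed under composition and under invertible 2-cells, such that (FS1) for all $e:X\to Y$ in $\mathscr{U}$ and $m:A\to B$ in $\mathscr{L}$, the square of functors (commuting up to the associativity isomorphism) with vertices $\mathscr{S}(Y,A),\mathscr{S}(X,A),\mathscr{S}(Y,B),\mathscr{S}(X,B)$, given by precomposition with $e$ and postcomposition with $m$, is a bipullback; (FS2) every morphism $f$ satisfies $f\cong m\circ e$ for some $e\in\mathscr{U}$, $m\in\mathscr{L}$. A bicategory $\mathscr{S}$ is fake pullback ready when it is locally preordered and equipped with a factorization system $(\mathscr{U},\mathscr{L})$ satisfying: V1. Bipullbacks of morphisms in $\mathscr{U}$ along morphisms in $\mathscr{U}$ exist and have projections in $\mathscr{U}$; bipullbacks of morphisms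 in $\mathscr{L}$ along morphisms in $\mathscr{L}$ exist and have projections in $\mathscr{L}$. V2. Given $X\xrightarrow{a}Z\xleftarrow{x}Y$ with $a\in\mathscr{U}$, $x\in\mathscr{L}$, there exist $b:U\to Y$ in $\mathscr{U}$, $y:U\to X$ in $\mathscr{L}$ and a 2-cell $x\circ b\Rightarrow a\circ y$; this square is unique up to equivalence (any two choices of $(U,b,y)$ are related by an equivalence of the objects $U$ compatible with $b$ and $y$ up to invertible 2-cells). V3. Given $x:X\to Y$, $y:A\to B$, $r:X\to A$, $s:Y\to B$, $t:Z\to C$ in $\mathscr{L}$ and $a:Y\to Z$, $b:B\to C$ in $\mathscr{U}$, such that $s\circ x\cong y\circ r$ is a bipullback square (of $s$ and $y$) and there is a 2-cell $t\circ a\Rightarrow b\circ s$; and given factorizations $a\circ x\cong v\circ c$ (through $I$) and $b\circ y\cong w\circ d$ (through $J$) with $c:X\to I$, $d:A\to J$ in $\mathscr{U}$ and $v:I\to Z$, $w:J\to C$ in $\mathscr{L}$; there exists $q:I\to J$ in $\mathscr{L}$ with a 2-cell $q\circ c\Rightarrow d\circ r$ and with $t\circ v\cong w\circ q$ a bipullback square (of $t$ and $w$). V4. Given $x:X\to Y$, $u:D\to E$ in $\mathscr{L}$ and $h:E\to F$, $a:Y\to Z$, $e:D\to X$, $f:E\to Y$, $g:F\to Z$ in $\mathscr{U}$, such that there is a 2-cell $x\circ e\Rightarrow f\circ u$ and $g\circ h\cong a\circ f$ is a bipullback square (of $g$ and $a$); and given factorizations $h\circ u\cong p\circ k$ (through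 $K$) and $a\circ x\cong v\circ c$ (through $I$) with $k:D\to K$, $c:X\to I$ in $\mathscr{U}$ and $p:K\to F$, $v:I\to Z$ in $\mathscr{L}$; there exists $j:K\to I$ in $\mathscr{U}$ with $j\circ k\cong c\circ e$ a bipullback square (of $j$ and $c$) and a 2-cell $v\circ j\Rightarrow g\circ p$. Fake pullback of a cospan $U\xrightarrow{r}W\xleftarrow{s}V$ in a fake pullback ready $\mathscr{S}$: factorize $r\cong x\circ a$ with $a:U\to R$ in $\mathscr{U}$, $x:R\to W$ in $\mathscr{L}$, and $s\cong y\circ b$ with $b:V\to S$ in $\mathscr{U}$, $y:S\to W$ in $\mathscr{L}$. Take the bipullback $R\xleftarrow{y'}Z\xrightarrow{x'}S$ of $x$ and $y$ (V1). By V2 choose $\bar a:X\to Z$ in $\mathscr{U}$ and $\bar y:X\to U$ in $\mathscr{L}$ with a 2-cell $y'\circ\bar a\Rightarrow a\circ\bar y$, and $\bar b:Y\to Z$ in $\mathscr{U}$ and $\bar x:Y\to V$ in $\mathscr{L}$ with a 2-cell $x'\circ\bar b\Rightarrow b\circ\bar x$. Take the bipullback $X\xleftarrow{b'}Q\xrightarrow{a'}Y$ of $\bar a$ and $\bar b$ (V1). The span $U\xleftarrow{\bar y\circ b'}Q\xrightarrow{\bar x\circ a'}V$ is the fake pullback; it is determined up to isomorphism of spans, and any span isomorphic to it is called a fake pullback. Isomorphism of spans: $X\xleftarrow{p}S\xrightarrow{q}Y$ and $X\xleftarrow{p'}S'\xrightarrow{q'}Y$ in $\mathscr{S}$ are isomorphic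 when there is an equivalence $h:S\to S'$ in $\mathscr{S}$ with $p'\circ h\cong p$ and $q'\circ h\cong q$. *)

(* Defs.v *)
(* Composition is written in applicative order throughout. *)
From Stdlib Require Import ssreflect ProofIrrelevance.

Set Implicit Arguments.
Unset Strict Implicit.
Unset Printing Implicit Defensive.

Record category_on (O : Type) (H : O -> O -> Type) : Type := CategoryOn {
  idm : forall x, H x x;
  compm : forall x y z, H y z -> H x y -> H x z;
  comp_id_l : forall x y (f : H x y), compm (idm y) f = f;
  comp_id_r : forall x y (f : H x y), compm f (idm x) = f;
  comp_assoc : forall w x y z (h : H y z) (g : H x y) (f : H w x),
    compm (compm h g) f = compm h (compm g f) }.

Record category : Type := Category {
  obj :> Type;
  mor : obj -> obj -> Type;
  cat_on :> category_on mor }.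

Arguments idm {O H} c x.
Arguments compm {O H} c {x y z} g f.
Arguments comp_id_l {O H} c {x y} f.
Arguments comp_id_r {O H} c {x y} f.
Arguments comp_assoc {O H} c {w x y z} h g f.
Arguments mor {c} x y.

Notation "1c" := (idm (cat_on _) _).
Notation "g • f" := (compm (cat_on _) g f) (at level 40, left associativity).

Record iso (C : category) (x y : C) : Type := Iso {
  fwd :> mor x y;
  bwd : mor y x;
  bwd_fwd : bwd • fwd = 1c;
  fwd_bwd : fwd • bwd = 1c }.

Notation "x ≅ y" := (inhabited (iso x y)) (at level 70, no associativity).

Definition iso_sym (C : category) (x y : C) (i : iso x y) : iso y x :=
  @Iso C y x (bwd i) i (fwd_bwd i) (bwd_fwd i).

Lemma comp_cancel_mid (C : category) (v w x y z : C) (f : mor v w) (g : mor w x)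
    (h : mor x w) (k : mor w z) :
  h • g = 1c -> (k • h) • (g • f) = k • f.
Proof.
move=> e; rewrite comp_assoc -(comp_assoc (cat_on _) h g f) e comp_id_l //.
Qed.

Definition iso_trans (C : category) (x y z : C) (j : iso y z) (i : iso x y) :
  iso x z.
Proof.
refine (@Iso C x z (j • i) (bwd i • bwd j) _ _).
- by rewrite comp_cancel_mid ?bwd_fwd.
- by rewrite comp_cancel_mid ?fwd_bwd.
Defined.

Record functor (C D : category) : Type := Functor {
  fobj :> C -> D;
  fmap : forall x y : C, mor x y -> mor (fobj x) (fobj y);
  fmap_id : forall x : C, fmap (idm C x) = 1c;
  fmap_comp : forall (x y z : C) (g : mor y z) (f : mor x y),
    fmap (g • f) = fmap g • fmap f }.

Arguments fmap {C D} F {x y} f : rename.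

Definition functor_id (C : category) : functor C C :=
  @Functor C C (fun x => x) (fun x y f => f)
    (fun x => eq_refl) (fun x y z g f => eq_refl).

Definition functor_comp (C D E : category) (G : functor D E) (F : functor C D) :
  functor C E.
Proof.
refine (@Functor C E (fun x => G (F x)) (fun x y f => fmap G (fmap F f)) _ _).
- by move=> x; rewrite !fmap_id.
- by move=> x y z g f; rewrite !fmap_comp.
Defined.

Record nat_iso (C D : category) (F G : functor C D) : Type := NatIso {
  nat_iso_at :> forall x : C, iso (F x) (G x);
  nat_iso_natural : forall (x y : C) (f : mor x y),
    nat_iso_at y • fmap F f = fmap G f • nat_iso_at x }.

Definition is_equivalence_of_categories (C D : category) (F : functor C D) : Prop :=
  exists G : functor D C,
    inhabited (nat_iso (functor_comp G F) (functor_id C)) /\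
    inhabited (nat_iso (functor_comp F G) (functor_id D)).

Section IsoComma.
Variables (A B C : category) (F : functor A C) (G : functor B C).

Record isocomma_obj : Type := IsoCommaObj {
  ic_l : A;
  ic_r : B;
  ic_iso : iso (F ic_l) (G ic_r) }.

Record isocomma_mor (x y : isocomma_obj) : Type := IsoCommaMor {
  icm_l : mor (ic_l x) (ic_l y);
  icm_r : mor (ic_r x) (ic_r y);
  icm_comm : ic_iso y • fmap F icm_l = fmap G icm_r • ic_iso x }.

Lemma isocomma_mor_eq (x y : isocomma_obj) (f g : isocomma_mor x y) :
  icm_l f = icm_l g -> icm_r f = icm_r g -> f = g.
Proof.
case: f g => [fl fr fc] [gl gr gc] /= el er; subst gl gr.
by rewrite (proof_irrelevance _ fc gc).
Qed.

Definition isocomma_id (x : isocomma_obj) : isocomma_mor x x.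
Proof.
apply: (@IsoCommaMor x x 1c 1c).
by rewrite !fmap_id comp_id_l comp_id_r.
Defined.

Definition isocomma_comp (x y z : isocomma_obj)
    (g : isocomma_mor y z) (f : isocomma_mor x y) : isocomma_mor x z.
Proof.
apply: (@IsoCommaMor x z (icm_l g • icm_l f) (icm_r g • icm_r f)).
by rewrite !fmap_comp -comp_assoc icm_comm comp_assoc icm_comm comp_assoc.
Defined.

Definition isocomma_on : category_on isocomma_mor.
Proof.
apply: (@CategoryOn _ _ isocomma_id isocomma_comp).
- by move=> x y f; apply: isocomma_mor_eq; rewrite /= comp_id_l.
- by move=> x y f; apply: isocomma_mor_eq; rewrite /= comp_id_r.
- by move=> w x y z h g f; apply: isocomma_mor_eq; rewrite /= comp_assoc.
Defined.

Definition isocomma : category := Category isocomma_on.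

Variables (D : category) (P : functor D A) (Q : functor D B)
  (theta : nat_iso (functor_comp F P) (functor_comp G Q)).

Definition comparison : functor D isocomma.
Proof.
refine (@Functor D isocomma (fun d => @IsoCommaObj (P d) (Q d) (theta d))
  (fun x y f => @IsoCommaMor (@IsoCommaObj (P x) (Q x) (theta x))
     (@IsoCommaObj (P y) (Q y) (theta y)) (fmap P f) (fmap Q f)
     (nat_iso_natural theta f)) _ _).
- by move=> x; apply: isocomma_mor_eq; rewrite /= fmap_id.
- by move=> x y z g f; apply: isocomma_mor_eq; rewrite /= fmap_comp.
Defined.

(* The functors P and Q exhibit D, up to equivalence, as the pseudopullback
   (iso-comma category) of F and G. *)
Definition is_bipullback_of_categories : Prop :=
  is_equivalence_of_categories comparison.

End IsoComma.

Record bicategory : Type := Bicategory {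
  bob :> Type;
  bhom :> bob -> bob -> category;
  id1 : forall X, bhom X X;
  comp1 : forall X Y Z, bhom Y Z -> bhom X Y -> bhom X Z;
  hcomp : forall X Y Z (g g' : bhom Y Z) (f f' : bhom X Y),
    mor g g' -> mor f f' -> mor (comp1 g f) (comp1 g' f');
  hcomp_id : forall X Y Z (g : bhom Y Z) (f : bhom X Y),
    hcomp (idm (bhom Y Z) g) (idm (bhom X Y) f) = 1c;
  hcomp_comp : forall X Y Z (g g' g'' : bhom Y Z) (f f' f'' : bhom X Y)
      (b' : mor g' g'') (b : mor g g') (a' : mor f' f'') (a : mor f f'),
    hcomp (b' • b) (a' • a) = hcomp b' a' • hcomp b a;
  associator : forall W X Y Z (h : bhom Y Z) (g : bhom X Y) (f : bhom W X),
    iso (comp1 (comp1 h g) f) (comp1 h (comp1 g f));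
  associator_natural : forall W X Y Z (h h' : bhom Y Z) (g g' : bhom X Y)
      (f f' : bhom W X) (c : mor h h') (b : mor g g') (a : mor f f'),
    associator h' g' f' • hcomp (hcomp c b) a
    = hcomp c (hcomp b a) • associator h g f;
  lunitor : forall X Y (f : bhom X Y), iso (comp1 (id1 Y) f) f;
  lunitor_natural : forall X Y (f f' : bhom X Y) (a : mor f f'),
    lunitor f' • hcomp (idm (bhom Y Y) (id1 Y)) a = a • lunitor f;
  runitor : forall X Y (f : bhom X Y), iso (comp1 f (id1 X)) f;
  runitor_natural : forall X Y (f f' : bhom X Y) (a : mor f f'),
    runitor f' • hcomp a (idm (bhom X X) (id1 X)) = a • runitor f;
  pentagon : forall V W X Y Z
      (k : bhom Y Z) (h : bhom X Y) (g : bhom W X) (f : bhom V W),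
    associator k h (comp1 g f) • associator (comp1 k h) g f
    = hcomp (idm (bhom Y Z) k) (associator h g f)
        • associator k (comp1 h g) f
        • hcomp (associator k h g) (idm (bhom V W) f);
  triangle : forall X Y Z (g : bhom Y Z) (f : bhom X Y),
    hcomp (idm (bhom Y Z) g) (lunitor f) • associator g (id1 Y) f
    = hcomp (runitor g) (idm (bhom X Y) f) }.

Arguments id1 {_} X.
Notation "g ∘ f" := (comp1 g f) (at level 40, left associativity).
Notation "f ⇒ g" := (inhabited (mor f g)) (at level 70, no associativity).

Definition locally_preordered (S : bicategory) : Prop :=
  forall (X Y : S) (f g : S X Y) (a b : mor f g), a = b.

Definition is_equiv (S : bicategory) (X Y : S) (f : S X Y) : Prop :=
  exists g : S Y X, (g ∘ f ≅ id1 X) /\ (f ∘ g ≅ id1 Y).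

Section Bipullback.
Variable S : bicategory.

Definition postcomp (K X Y : S) (f : S X Y) : functor (S K X) (S K Y).
Proof.
refine (@Functor (S K X) (S K Y) (fun k => f ∘ k)
  (fun k k' a => hcomp (idm (S X Y) f) a) _ _).
- by move=> k; apply: hcomp_id.
- by move=> k k' k'' b a; rewrite -hcomp_comp comp_id_l.
Defined.

Definition precomp (X Y K : S) (e : S X Y) : functor (S Y K) (S X K).
Proof.
refine (@Functor (S Y K) (S X K) (fun k => k ∘ e)
  (fun k k' a => hcomp a (idm (S X Y) e)) _ _).
- by move=> k; apply: hcomp_id.
- by move=> k k' k'' b a; rewrite -hcomp_comp comp_id_l.
Defined.

Definition iso_whisker_r (X Y Z : S) (g g' : S Y Z) (i : iso g g') (f : S X Y) :
  iso (g ∘ f) (g' ∘ f).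
Proof.
refine (@Iso (S X Z) (g ∘ f) (g' ∘ f) (hcomp i (idm (S X Y) f))
  (hcomp (bwd i) (idm (S X Y) f)) _ _).
- by rewrite -hcomp_comp bwd_fwd comp_id_l hcomp_id.
- by rewrite -hcomp_comp fwd_bwd comp_id_l hcomp_id.
Defined.

Lemma associator_bwd_natural (W X Y Z : S) (h h' : S Y Z) (g g' : S X Y)
    (f f' : S W X) (c : mor h h') (b : mor g g') (a : mor f f') :
  bwd (associator h' g' f') • hcomp c (hcomp b a)
  = hcomp (hcomp c b) a • bwd (associator h g f).
Proof.
rewrite -(comp_id_r (cat_on _) (hcomp c (hcomp b a))) -(fwd_bwd (associator h g f)).
rewrite -(comp_assoc (cat_on _) (hcomp c (hcomp b a))) -associator_natural.
by rewrite -!comp_assoc bwd_fwd comp_id_l.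
Qed.

Section Square.
Variables (A B C P : S) (f : S A C) (g : S B C) (p : S P A) (q : S P B)
  (theta : iso (f ∘ p) (g ∘ q)).

Lemma bipullback_natural (K : S) (k k' : S K P) (a : mor k k') :
  (associator g q k' • (hcomp theta (idm (S K P) k') • bwd (associator f p k')))
    • hcomp (idm (S A C) f) (hcomp (idm (S P A) p) a)
  = hcomp (idm (S B C) g) (hcomp (idm (S P B) q) a)
    • (associator g q k • (hcomp theta (idm (S K P) k) • bwd (associator f p k))).
Proof.
have slide : hcomp theta (idm (S K P) k') • hcomp (idm (S P C) (f ∘ p)) a
  = hcomp (idm (S P C) (g ∘ q)) a • hcomp theta (idm (S K P) k).
  by rewrite -!hcomp_comp !comp_id_l !comp_id_r.
rewrite !comp_assoc associator_bwd_natural hcomp_id.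
rewrite -(comp_assoc (cat_on _) (hcomp theta _)) slide -!comp_assoc.
by rewrite -associator_natural hcomp_id.
Qed.

Definition bipullback_nat_iso (K : S) :
  nat_iso (functor_comp (postcomp K f) (postcomp K p))
          (functor_comp (postcomp K g) (postcomp K q)) :=
  @NatIso _ _ (functor_comp (postcomp K f) (postcomp K p))
    (functor_comp (postcomp K g) (postcomp K q))
    (fun k => iso_trans (associator g q k)
       (iso_trans (iso_whisker_r theta k) (iso_sym (associator f p k))))
    (@bipullback_natural K).

(* Bipullbacks are representable: each hom-functor S(K,-) carries the square to
   a bipullback of categories. *)
Definition is_bipullback : Prop :=
  forall K : S, is_bipullback_of_categories (bipullback_nat_iso K).

End Square.

Definition bipullback_square (A B C P : S) (f : S A C) (g : S B C)
    (p : S P A) (q : S P B) : Prop :=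
  exists theta : iso (f ∘ p) (g ∘ q), is_bipullback theta.

(* The square from S(Y,A) to S(X,B) whose two composites are k |-> m ∘ (k ∘ e)
   and k |-> (m ∘ k) ∘ e. *)
Definition orthogonality_nat_iso (X Y A B : S) (e : S X Y) (m : S A B) :
  nat_iso (functor_comp (postcomp X m) (precomp A e))
          (functor_comp (precomp B e) (postcomp Y m)).
Proof.
refine (@NatIso _ _ (functor_comp (postcomp X m) (precomp A e))
  (functor_comp (precomp B e) (postcomp Y m))
  (fun k => iso_sym (associator m k e)) _).
by move=> k k' a /=; apply: associator_bwd_natural.
Defined.

End Bipullback.

Definition morphism_class (S : bicategory) : Type :=
  forall X Y : S, S X Y -> Prop.

Record admissible_class (S : bicategory) (M : morphism_class S) : Prop := {
  class_equiv : forall (X Y : S) (f : S X Y), is_equiv f -> M X Y f;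
  class_comp : forall (X Y Z : S) (g : S Y Z) (f : S X Y),
    M Y Z g -> M X Y f -> M X Z (g ∘ f);
  class_iso : forall (X Y : S) (f g : S X Y), f ≅ g -> M X Y f -> M X Y g }.

Record factorization_system (S : bicategory) : Type := FactorizationSystem {
  inU : morphism_class S;
  inL : morphism_class S;
  inU_admissible : admissible_class inU;
  inL_admissible : admissible_class inL;
  FS1 : forall (X Y A B : S) (e : S X Y) (m : S A B),
    inU e -> inL m -> is_bipullback_of_categories (orthogonality_nat_iso e m);
  FS2 : forall (X Y : S) (f : S X Y), exists (Z : S) (e : S X Z) (m : S Z Y),
    inU e /\ inL m /\ (f ≅ m ∘ e) }.

Arguments inU {S} f {X Y} _ : rename.
Arguments inL {S} f {X Y} _ : rename.

Record fake_pullback_ready (S : bicategory) (F : factorization_system S) : Prop := {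
  fpr_preordered : locally_preordered S;

  V1_U : forall (A B C : S) (f : S A C) (g : S B C), inU F f -> inU F g ->
    (exists (P : S) (p : S P A) (q : S P B), bipullback_square f g p q) /\
    (forall (P : S) (p : S P A) (q : S P B),
       bipullback_square f g p q -> inU F p /\ inU F q);

  V1_L : forall (A B C : S) (f : S A C) (g : S B C), inL F f -> inL F g ->
    (exists (P : S) (p : S P A) (q : S P B), bipullback_square f g p q) /\
    (forall (P : S) (p : S P A) (q : S P B),
       bipullback_square f g p q -> inL F p /\ inL F q);

  V2_exists : forall (X Y Z : S) (a : S X Z) (x : S Y Z), inU F a -> inL F x ->
    exists (U : S) (b : S U Y) (y : S U X),
      inU F b /\ inL F y /\ (x ∘ b ⇒ a ∘ y);

  V2_unique : forall (X Y Z : S) (a : S X Z) (x : S Y Z), inU F a -> inL F x ->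
    forall (U : S) (b : S U Y) (y : S U X) (U' : S) (b' : S U' Y) (y' : S U' X),
      inU F b -> inL F y -> (x ∘ b ⇒ a ∘ y) ->
      inU F b' -> inL F y' -> (x ∘ b' ⇒ a ∘ y') ->
      exists h : S U U', is_equiv h /\ (b' ∘ h ≅ b) /\ (y' ∘ h ≅ y);

  V3 : forall (X Y A B Z C I J : S)
      (x : S X Y) (y : S A B) (r : S X A) (s : S Y B) (t : S Z C)
      (a : S Y Z) (b : S B C)
      (c : S X I) (v : S I Z) (d : S A J) (w : S J C),
    inL F x -> inL F y -> inL F r -> inL F s -> inL F t ->
    inU F a -> inU F b ->
    bipullback_square s y x r ->
    (t ∘ a ⇒ b ∘ s) ->
    inU F c -> inL F v -> (a ∘ x ≅ v ∘ c) ->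
    inU F d -> inL F w -> (b ∘ y ≅ w ∘ d) ->
    exists q : S I J,
      inL F q /\ (q ∘ c ⇒ d ∘ r) /\ bipullback_square t w v q;

  V4 : forall (X Y Z D E G I K : S)
      (x : S X Y) (u : S D E)
      (h : S E G) (a : S Y Z) (e : S D X) (f : S E Y) (g : S G Z)
      (k : S D K) (p : S K G) (c : S X I) (v : S I Z),
    inL F x -> inL F u ->
    inU F h -> inU F a -> inU F e -> inU F f -> inU F g ->
    (x ∘ e ⇒ f ∘ u) ->
    bipullback_square g a h f ->
    inU F k -> inL F p -> (h ∘ u ≅ p ∘ k) ->
    inU F c -> inL F v -> (a ∘ x ≅ v ∘ c) ->
    exists j : S K I,
      inU F j /\ bipullback_square j c k e /\ (v ∘ j ⇒ g ∘ p) }.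

Record span (S : bicategory) (X Y : S) : Type := Span {
  apex : S;
  leg_l : S apex X;
  leg_r : S apex Y }.

Definition span_iso (S : bicategory) (X Y : S) (s t : span X Y) : Prop :=
  exists h : S (apex s) (apex t),
    is_equiv h /\ (leg_l t ∘ h ≅ leg_l s) /\ (leg_r t ∘ h ≅ leg_r s).

(* Isomorphism classes are taken to be the sets of spans isomorphic to a given
   one. *)
Definition span_class (S : bicategory) (X Y : S) : Type :=
  {c : span X Y -> Prop | exists s, c = span_iso s}.

Definition class_of (S : bicategory) (X Y : S) (s : span X Y) : span_class X Y :=
  exist _ (span_iso s) (ex_intro _ s eq_refl).

(* One run of the construction, sp being its output: the factorizations of r and
   s, the bipullback, the two V2 squares and the last bipullback are arbitrary. *)
Definition fake_pullback_construction (S : bicategory) (F : factorization_system S)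
    (U V W : S) (r : S U W) (s : S V W) (sp : span U V) : Prop :=
  exists (R : S) (a : S U R) (x : S R W) (T : S) (b : S V T) (y : S T W)
         (Z : S) (y' : S Z R) (x' : S Z T)
         (X : S) (abar : S X Z) (ybar : S X U)
         (Y : S) (bbar : S Y Z) (xbar : S Y V)
         (Q : S) (b' : S Q X) (a' : S Q Y),
    (inU F a /\ inL F x /\ (r ≅ x ∘ a)) /\
    (inU F b /\ inL F y /\ (s ≅ y ∘ b)) /\
    bipullback_square x y y' x' /\
    (inU F abar /\ inL F ybar /\ (y' ∘ abar ⇒ a ∘ ybar)) /\
    (inU F bbar /\ inL F xbar /\ (x' ∘ bbar ⇒ b ∘ xbar)) /\
    bipullback_square abar bbar b' a' /\
    sp = Span (ybar ∘ b') (xbar ∘ a').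

Definition is_fake_pullback (S : bicategory) (F : factorization_system S)
    (U V W : S) (r : S U W) (s : S V W) (sp : span U V) : Prop :=
  exists sp0 : span U V,
    fake_pullback_construction F r s sp0 /\ span_iso sp sp0.

(* (p,q) and (p',q') with (u,v) over their middle legs give (p ∘ u, q' ∘ v). *)
Definition span_comp_along (S : bicategory) (X Y Z : S)
    (s : span X Y) (t : span Y Z) (fp : span (apex s) (apex t)) : span X Z :=
  Span (leg_l s ∘ leg_l fp) (leg_r t ∘ leg_r fp).

(* Main.v *)
(* In the grid computing a fake pullback of r ≅ x ∘ a and s ≅ y ∘ b each cell is
   a bipullback or a V2 square, and both kinds are determined by their cospan up
   to equivalence; hence fake pullbacks are unique and invariant under
   equivalence.  Associativity follows from the pasting of fake pullbacks: two
   grids side by side form a grid whose columns are y, b, y', b'; by V3 (row x)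
   and V4 (row a) the columns b, y' can be replaced by the two factors of
   b ∘ y', after which bipullbacks paste with bipullbacks and V2 squares with V2
   squares. *)
From Stdlib Require Import ssreflect Setoid Morphisms ProofIrrelevance.
From Stdlib Require Import FunctionalExtensionality PropExtensionality.
From Stdlib Require Import IndefiniteDescription.
Require Import Defs.

Set Implicit Arguments.
Unset Strict Implicit.
Unset Printing Implicit Defensive.

(** * Thin categories and equivalences between them *)

Definition thin (C : category) : Prop :=
  forall (x y : C) (a b : mor x y), a = b.

Lemma thin_iso (C : category) (x y : C) :
  thin C -> (x ⇒ y) -> (y ⇒ x) -> x ≅ y.
Proof.
move=> tC [f] [g]; constructor.
by apply: (@Iso C x y f g); apply: tC.
Qed.

Lemma thin_isocomma (A B C : category) (F : functor A C) (G : functor B C) :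
  thin A -> thin B -> thin (isocomma F G).
Proof.
by move=> tA tB x y f g; apply: isocomma_mor_eq; [apply: tA | apply: tB].
Qed.

Lemma iso_fwd (C : category) (x y : C) : x ≅ y -> x ⇒ y.
Proof. by case=> i; constructor; apply: fwd i. Qed.

Lemma iso_bwd (C : category) (x y : C) : x ≅ y -> y ⇒ x.
Proof. by case=> i; constructor; apply: bwd i. Qed.

(** For the converse, a quasi-inverse is assembled from chosen preimages. Thinness of both
    categories supplies functoriality and naturality, so only the existence of arrows has to be
    checked. *)
Lemma thin_equivalenceP (C D : category) (F : functor C D) :
  thin C -> thin D ->
  is_equivalence_of_categories F <->
  (forall x y : C, (F x ⇒ F y) -> x ⇒ y) /\ (forall d : D, exists c, F c ≅ d).
Proof.
move=> tC tD; split.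
- case=> G [[eta] [eps]]; split.
  + move=> x y [f]; constructor.
    exact: (eta y • (fmap G f • bwd (eta x))).
  + by move=> d; exists (G d); constructor; apply: (eps d).
- case=> full surj.
  have G0 d : {c : C | F c ≅ d} by apply: constructive_indefinite_description.
  (* The functor needs an arrow as data, while [full] gives only inhabitation; one is picked by
     description. *)
  have lift d d' : mor d d' -> mor (proj1_sig (G0 d)) (proj1_sig (G0 d')).
    move=> f; suff: exists g : mor (proj1_sig (G0 d)) (proj1_sig (G0 d')), True.
      by case/constructive_indefinite_description.
    have [g] : proj1_sig (G0 d) ⇒ proj1_sig (G0 d'); last by exists g.
    apply: full.
    case: (proj2_sig (G0 d)) => i; case: (proj2_sig (G0 d')) => i'.
    by constructor; apply: (bwd i' • (f • fwd i)).
  exists (@Functor D C (fun d => proj1_sig (G0 d)) lift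
    (fun d => tC _ _ _ _) (fun d d' d'' g f => tC _ _ _ _)).
  have nat (E E' : category) (H K : functor E E') (tE : thin E') :
      (forall x, H x ≅ K x) -> inhabited (nat_iso H K).
    move=> h; have k x : {i : iso (H x) (K x) | True}.
      by apply: constructive_indefinite_description; case: (h x) => i; exists i.
    constructor; apply: (@NatIso E E' H K (fun x => proj1_sig (k x))) => x y f.
    exact: tE.
  split; apply: nat => // x /=.
  + apply: thin_iso => //; apply: full.
    * exact: iso_fwd (proj2_sig (G0 _)).
    * exact: iso_bwd (proj2_sig (G0 _)).
  + exact: proj2_sig (G0 x).
Qed.

(** * Hom-categories as preorders, and rewriting of 1-cells *)

(** Named relations, so that setoid rewriting resolves the instances below instead of meeting a bare
    [inhabited]. *)
Definition le1 (S : bicategory) (X Y : S) (f g : S X Y) : Prop := f ⇒ g.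
Definition iso1 (S : bicategory) (X Y : S) (f g : S X Y) : Prop := f ≅ g.

Notation "f ≲ g" := (le1 f g) (at level 70, no associativity).
Notation "f ≃ g" := (iso1 f g) (at level 70, no associativity).

Instance le1_preorder (S : bicategory) (X Y : S) : PreOrder (@le1 S X Y).
Proof.
split.
- by move=> f; constructor; apply: 1c.
- by move=> f g h [a] [b]; constructor; apply: (b • a).
Qed.

Instance iso1_equivalence (S : bicategory) (X Y : S) : Equivalence (@iso1 S X Y).
Proof.
split.
- move=> f; constructor; apply: (@Iso (S X Y) f f 1c 1c); exact: comp_id_l.
- by move=> f g [i]; constructor; apply: iso_sym.
- by move=> f g h [i] [j]; constructor; apply: iso_trans j i.
Qed.

(* Without it, ssreflect's rewrite unfolds le1 in search of an equation. *)
Instance le1_rewrite_relation (S : bicategory) (X Y : S) :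
  RewriteRelation (@le1 S X Y) := {}.

#[local] Hint Extern 0 (le1 _ _) => reflexivity : core.
#[local] Hint Extern 0 (iso1 _ _) => reflexivity : core.

Instance iso1_le1 (S : bicategory) (X Y : S) : subrelation (@iso1 S X Y) (@le1 S X Y).
Proof. by move=> f g; apply: iso_fwd. Qed.

Instance le1_iso1_proper (S : bicategory) (X Y : S) :
  Proper (@iso1 S X Y ==> @iso1 S X Y ==> iff) (@le1 S X Y).
Proof.
move=> f f' e g g' e'; split=> h.
- exact: transitivity (iso_bwd e) (transitivity h (iso_fwd e')).
- exact: transitivity (iso_fwd e) (transitivity h (iso_bwd e')).
Qed.

Instance comp1_le1 (S : bicategory) (X Y Z : S) :
  Proper (@le1 S Y Z ==> @le1 S X Y ==> @le1 S X Z) (@comp1 S X Y Z).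
Proof. by move=> g g' [b] f f' [a]; constructor; apply: hcomp. Qed.

Instance comp1_iso1 (S : bicategory) (X Y Z : S) :
  Proper (@iso1 S Y Z ==> @iso1 S X Y ==> @iso1 S X Z) (@comp1 S X Y Z).
Proof.
move=> g g' [b] f f' [a]; constructor.
apply: (@Iso _ _ _ (hcomp b a) (hcomp (bwd b) (bwd a))).
- by rewrite -hcomp_comp !bwd_fwd hcomp_id.
- by rewrite -hcomp_comp !fwd_bwd hcomp_id.
Qed.

Lemma comp1A (S : bicategory) (W X Y Z : S) (h : S Y Z) (g : S X Y) (f : S W X) :
  h ∘ g ∘ f ≃ h ∘ (g ∘ f).
Proof. by constructor; apply: associator. Qed.

Lemma comp1_1l (S : bicategory) (X Y : S) (f : S X Y) : id1 Y ∘ f ≃ f.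
Proof. by constructor; apply: lunitor. Qed.

Lemma comp1_1r (S : bicategory) (X Y : S) (f : S X Y) : f ∘ id1 X ≃ f.
Proof. by constructor; apply: runitor. Qed.

(** Composites are kept bracketed to the right, so a commuting square has to be applicable in front
    of a further factor [m]; [comp1_inv] does the same for an inverse law. *)
Lemma comp1_iso_pre (S : bicategory) (X Y Y' Z : S) (f : S Y Z) (p : S X Y)
    (g : S Y' Z)
    (q : S X Y') : f ∘ p ≃ g ∘ q ->
  forall (K : S) (m : S K X), f ∘ (p ∘ m) ≃ g ∘ (q ∘ m).
Proof. by move=> e K m; rewrite -!comp1A e. Qed.

Lemma comp1_inv (S : bicategory) (X Y : S) (f : S Y X) (g : S X Y) :
  f ∘ g ≃ id1 X -> forall (K : S) (m : S K X), f ∘ (g ∘ m) ≃ m.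
Proof. by move=> e K m; rewrite -comp1A e comp1_1l. Qed.

(** * Equivalences in a bicategory *)

Lemma is_equivI (S : bicategory) (X Y : S) (f : S X Y) (g : S Y X) :
  g ∘ f ≃ id1 X -> f ∘ g ≃ id1 Y -> is_equiv f.
Proof. by move=> gf fg; exists g. Qed.

Lemma is_equivE (S : bicategory) (X Y : S) (f : S X Y) :
  is_equiv f -> exists g : S Y X,
    (g ∘ f ≃ id1 X) /\ (f ∘ g ≃ id1 Y) /\ is_equiv g.
Proof. by case=> g [gf fg]; exists g; split=> //; split=> //; exists f. Qed.

Lemma is_equiv_id (S : bicategory) (X : S) : is_equiv (id1 X).
Proof. by apply: (is_equivI (g := id1 X)); apply: comp1_1l. Qed.

Lemma is_equiv_comp (S : bicategory) (X Y Z : S) (g : S Y Z) (f : S X Y) :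
  is_equiv g -> is_equiv f -> is_equiv (g ∘ f).
Proof.
move=> /is_equivE [g' [g'g [gg' _]]] /is_equivE [f' [f'f [ff' _]]].
apply: (is_equivI (g := f' ∘ g')).
- by rewrite comp1A (comp1_inv g'g).
- by rewrite comp1A (comp1_inv ff').
Qed.

Lemma equiv_cancel_le (S : bicategory) (W X Y : S) (i : S X Y) (m m' : S W X) :
  is_equiv i -> i ∘ m ≲ i ∘ m' -> m ≲ m'.
Proof.
move=> /is_equivE [i' [i'i _]] h.
by rewrite -(comp1_inv i'i m) h (comp1_inv i'i).
Qed.

Lemma equiv_cancel_iso (S : bicategory) (W X Y : S) (i : S X Y) (m m' : S W X) :
  is_equiv i -> i ∘ m ≃ i ∘ m' -> m ≃ m'.
Proof.
move=> /is_equivE [i' [i'i _]] h.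
by rewrite -(comp1_inv i'i m) h (comp1_inv i'i).
Qed.

(** * Bipullbacks in a locally preordered bicategory *)

(* Local preorderedness removes all coherence from the bipullback property: only
   the existence of mediating 1-cells and of 2-cells between them remain. *)
Definition bipb (S : bicategory) (A B C P : S) (f : S A C) (g : S B C)
    (p : S P A) (q : S P B) : Prop :=
  (f ∘ p ≃ g ∘ q) /\
  (forall (K : S) (m m' : S K P), p ∘ m ≲ p ∘ m' -> q ∘ m ≲ q ∘ m' -> m ≲ m') /\
  (forall (K : S) (h : S K A) (k : S K B), f ∘ h ≃ g ∘ k ->
     exists m : S K P, (p ∘ m ≃ h) /\ (q ∘ m ≃ k)).

Lemma le1_antisym (S : bicategory) (pre : locally_preordered S) (X Y : S)
    (f g : S X Y) : f ≲ g -> g ≲ f -> f ≃ g.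
Proof. exact: (thin_iso (C := S X Y)) (@pre X Y). Qed.

(** The hom-categories and the iso-comma categories are thin, so [thin_equivalenceP] splits the
    equivalence at each [K] into the two universal clauses of [bipb]; compatibility conditions
    between 2-cells hold by [pre]. *)
Lemma bipullback_squareP (S : bicategory) (pre : locally_preordered S)
    (A B C P : S) (f : S A C) (g : S B C) (p : S P A)
    (q : S P B) : bipullback_square f g p q <-> bipb f g p q.
Proof.
have tK (K : S) : thin (isocomma (postcomp K f) (postcomp K g)).
  by apply: thin_isocomma; apply: pre.
split.
- case=> theta bp; split; first by constructor.
  have {}bp K := proj1 (thin_equivalenceP _ (@pre K P) (tK K)) (bp K).
  split=> K.
  + move=> m m' [a] [b]; apply: (proj1 (bp K) m m'); constructor.
    by apply: (@IsoCommaMor _ _ _ _ _ (comparison (bipullback_nat_iso theta K) m)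
      (comparison (bipullback_nat_iso theta K) m') a b); apply: pre.
  + move=> h k [i]; have [m [j]] := proj2 (bp K) (@IsoCommaObj _ _ _
      (postcomp K f) (postcomp K g) h k i).
    (* The two directions of [j] are projected to components, and antisymmetry reassembles these
       into isomorphisms. *)
    exists m; split; apply: (le1_antisym pre); constructor.
    * exact: icm_l (fwd j).
    * exact: icm_l (bwd j).
    * exact: icm_r (fwd j).
    * exact: icm_r (bwd j).
- case=> [[theta]] [full surj]; exists theta => K.
  apply/(thin_equivalenceP _ (@pre K P) (tK K)); split.
  + by move=> m m' [a]; apply: full; constructor; [apply: icm_l a | apply: icm_r a].
  + case=> h k i; have [m [pm qm]] := surj K h k (inhabits i); exists m.
    case: pm qm => [u] [v]; apply: thin_iso; [exact: tK | | ]; constructor.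
    * by apply: (@IsoCommaMor _ _ _ _ _ (comparison (bipullback_nat_iso theta K) m)
        (@IsoCommaObj _ _ _ (postcomp K f) (postcomp K g) h k i) (fwd u) (fwd v));
        apply: pre.
    * by apply: (@IsoCommaMor _ _ _ _ _
        (@IsoCommaObj _ _ _ (postcomp K f) (postcomp K g) h k i)
        (comparison (bipullback_nat_iso theta K) m) (bwd u) (bwd v)); apply: pre.
Qed.

Lemma bipb_sym (S : bicategory) (A B C P : S) (f : S A C) (g : S B C)
    (p : S P A) (q : S P B) :
  bipb f g p q -> bipb g f q p.
Proof.
case=> e [mono surj]; split; first by rewrite e.
split=> K; first by move=> m m' hq hp; apply: mono.
by move=> h k hk; have [|m [pm qm]] := surj K k h; [rewrite hk | exists m].
Qed.

Lemma bipb_mono_iso (S : bicategory) (pre : locally_preordered S) (A B C P : S)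
    (f : S A C) (g : S B C) (p : S P A) (q : S P B) :
  bipb f g p q -> forall (K : S) (m m' : S K P),
  p ∘ m ≃ p ∘ m' -> q ∘ m ≃ q ∘ m' -> m ≃ m'.
Proof.
case=> _ [mono _] K m m' ep eq.
by apply: (le1_antisym pre); apply: mono; rewrite ?ep ?eq.
Qed.

Lemma bipb_unique (S : bicategory) (pre : locally_preordered S) (A B C P P' : S)
    (f : S A C) (g : S B C) (p : S P A) (q : S P B)
    (p' : S P' A) (q' : S P' B) :
  bipb f g p q -> bipb f g p' q' ->
  exists h : S P P', is_equiv h /\ (p' ∘ h ≃ p) /\ (q' ∘ h ≃ q).
Proof.
move=> b b'.
have [h [ph qh]] := proj2 (proj2 b') P p q (proj1 b).
have [h' [ph' qh']] := proj2 (proj2 b) P' p' q' (proj1 b').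
exists h; split=> //; apply: (is_equivI (g := h')).
- by apply: (bipb_mono_iso pre b); rewrite -comp1A ?ph' ?qh' ?ph ?qh comp1_1r.
- by apply: (bipb_mono_iso pre b'); rewrite -comp1A ?ph ?qh ?ph' ?qh' comp1_1r.
Qed.

Lemma bipb_transport (S : bicategory) (A B C A1 B1 C1 P : S) (f : S A C)
    (g : S B C) (p : S P A)
    (q : S P B) (f1 : S A1 C1) (g1 : S B1 C1) (i : S A A1) (j : S B B1) (l : S C C1) :
  is_equiv i -> is_equiv j -> is_equiv l ->
  f1 ∘ i ≃ l ∘ f -> g1 ∘ j ≃ l ∘ g ->
  bipb f g p q -> bipb f1 g1 (i ∘ p) (j ∘ q).
Proof.
move=> hi hj hl ef eg [e [mono surj]].
have [i' [i'i [ii' _]]] := is_equivE hi.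
have [j' [j'j [jj' _]]] := is_equivE hj.
split; first by rewrite (comp1_iso_pre ef) (comp1_iso_pre eg) e.
split=> K.
- by move=> m m'; rewrite !comp1A => /(equiv_cancel_le hi) ? /(equiv_cancel_le hj);
    apply: mono.
- move=> h k hk.
  (* The cone is carried back along the quasi-inverses of [i] and [j]; cancelling [l] shows that it
     lies over the original cospan. *)
  have [|m [pm qm]] := surj K (i' ∘ h) (j' ∘ k).
    apply: (equiv_cancel_iso hl).
    by rewrite -(comp1_iso_pre ef) -(comp1_iso_pre eg) (comp1_inv ii') (comp1_inv jj').
  exists m; by rewrite !comp1A pm qm (comp1_inv ii') (comp1_inv jj').
Qed.

Lemma bipb_apex (S : bicategory) (A B C P P' : S) (f : S A C) (g : S B C)
    (p : S P A)
    (q : S P B) (h : S P' P) :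
  is_equiv h -> bipb f g p q -> bipb f g (p ∘ h) (q ∘ h).
Proof.
move=> /is_equivE [h' [h'h [hh' eh']]] [e [mono surj]]; split.
  by rewrite -!comp1A e.
split=> K.
- move=> m m'; rewrite !comp1A => hp hq.
  by rewrite -(comp1_inv h'h m) -(comp1_inv h'h m') (mono _ _ _ hp hq).
- move=> a b /surj [m [pm qm]]; exists (h' ∘ m).
  by rewrite !comp1A (comp1_inv hh').
Qed.

Lemma bipb_id (S : bicategory) (A C : S) (f : S A C) : bipb f (id1 C) (id1 A) f.
Proof.
split; first by rewrite comp1_1l comp1_1r.
split=> K; first by move=> m m'; rewrite !comp1_1l.
by move=> h k; rewrite comp1_1l => e; exists h; rewrite comp1_1l.
Qed.

(** A 2-cell at [D] yields one at [B] through the second square, so the two clauses on 2-cells apply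
    in turn. A cone [h], [k] is first filled over [g' ∘ k], and the filler then forms a cone with
    [k] on the second square. *)
Lemma bipb_paste (S : bicategory) (A B C D P Q : S) (f : S A C) (g : S B C)
    (p : S P A) (q : S P B)
    (g' : S D B) (p' : S Q P) (q' : S Q D) :
  bipb f g p q -> bipb q g' p' q' -> bipb f (g ∘ g') (p ∘ p') q'.
Proof.
move=> [e [mono surj]] [e' [mono' surj']]; split.
  by rewrite comp1A -e' -!comp1A e.
split=> K.
- move=> m m'; rewrite !comp1A => hp hq; apply: mono' => //; apply: mono => //.
  by rewrite -!comp1A e' !comp1A hq.
- move=> h k; rewrite comp1A => /surj [m [pm qm]].
  have [n [pn qn]] := surj' K m k qm.
  by exists n; rewrite comp1A pn.
Qed.

(** * Orthogonality and uniqueness of factorizations *)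

(** FS1 read through [thin_equivalenceP]: fullness compares diagonal fillers, and essential
    surjectivity produces them. *)
Lemma orthogonality (S : bicategory) (F : factorization_system S)
    (pre : locally_preordered S) (X Y A B : S) (e : S X Y)
    (m : S A B) :
  inU F e -> inL F m ->
  (forall d d' : S Y A, d ∘ e ≲ d' ∘ e -> m ∘ d ≲ m ∘ d' -> d ≲ d') /\
  (forall (k : S X A) (h : S Y B), m ∘ k ≃ h ∘ e ->
     exists d : S Y A, (d ∘ e ≃ k) /\ (m ∘ d ≃ h)).
Proof.
move=> Ue Lm.
have tK : thin (isocomma (postcomp X m) (precomp B e)).
  by apply: thin_isocomma; apply: pre.
have [full surj] := proj1 (thin_equivalenceP _ (@pre Y A) tK) (FS1 Ue Lm).
split.
- move=> d d' [a] [b]; apply: (full d d'); constructor.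
  by apply: (@IsoCommaMor _ _ _ _ _ (comparison (orthogonality_nat_iso e m) d)
      (comparison (orthogonality_nat_iso e m) d') a b); apply: pre.
- move=> k h [i]; have [d [j]] := surj (@IsoCommaObj _ _ _
      (postcomp X m) (precomp B e) k h i).
  exists d; split; apply: (le1_antisym pre); constructor.
  + exact: icm_l (fwd j).
  + exact: icm_l (bwd j).
  + exact: icm_r (fwd j).
  + exact: icm_r (bwd j).
Qed.

Section FakePullback.
Variables (S : bicategory) (F : factorization_system S) (hS : fake_pullback_ready F).

Let pre : locally_preordered S := fpr_preordered hS.

Lemma inU_comp (X Y Z : S) (g : S Y Z) (f : S X Y) :
  inU F g -> inU F f -> inU F (g ∘ f).
Proof. exact: (class_comp (inU_admissible F)). Qed.

Lemma inL_comp (X Y Z : S) (g : S Y Z) (f : S X Y) :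
  inL F g -> inL F f -> inL F (g ∘ f).
Proof. exact: (class_comp (inL_admissible F)). Qed.

Lemma inU_equiv (X Y : S) (f : S X Y) : is_equiv f -> inU F f.
Proof. exact: (class_equiv (inU_admissible F)). Qed.

Lemma inL_equiv (X Y : S) (f : S X Y) : is_equiv f -> inL F f.
Proof. exact: (class_equiv (inL_admissible F)). Qed.

Definition factors (X Y Z : S) (f : S X Y) (m : S Z Y) (e : S X Z) : Prop :=
  inU F e /\ inL F m /\ (f ≃ m ∘ e).

Lemma factors_exists (X Y : S) (f : S X Y) :
  exists (Z : S) (m : S Z Y) (e : S X Z), factors f m e.
Proof. by have [Z [e [m h]]] := FS2 F f; exists Z, m, e. Qed.

(** Diagonal fillers in both directions are mutually inverse. *)
Lemma factors_unique (X Y Z Z' : S) (f : S X Y) (m : S Z Y) (e : S X Z)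
    (m' : S Z' Y) (e' : S X Z') :
  factors f m e -> factors f m' e' ->
  exists i : S Z Z', is_equiv i /\ (i ∘ e ≃ e') /\ (m' ∘ i ≃ m).
Proof.
move=> [Ue [Lm fme]] [Ue' [Lm' fme']].
have [|i [ie mi]] := proj2 (orthogonality pre Ue Lm') e' m.
  by rewrite -fme fme'.
have [|j [je mj]] := proj2 (orthogonality pre Ue' Lm) e m'.
  by rewrite -fme fme'.
(* An endomorphism of the middle object that fixes both factors is isomorphic to the identity, by
   comparison of fillers; this is applied to both composites of [i] and [j]. *)
have cancel (V : S) (n : S V Y) (g : S X V) (k : S V V) : inU F g -> inL F n ->
    k ∘ g ≃ g -> n ∘ k ≃ n -> k ≃ id1 V.
  move=> Ug Ln kg nk; have [mono _] := orthogonality pre Ug Ln.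
  by apply: (le1_antisym pre); apply: mono; rewrite ?kg ?nk ?comp1_1l ?comp1_1r.
exists i; split=> //; apply: (is_equivI (g := j)).
- by apply: (cancel _ m e) => //; rewrite ?comp1A ?ie // -comp1A mj.
- by apply: (cancel _ m' e') => //; rewrite ?comp1A ?je // -comp1A mi.
Qed.

(** * V2 squares and bipullbacks under equivalence of cospans *)

Definition vsq (X Y Z P : S) (a : S X Z) (x : S Y Z) (b : S P Y) (y : S P X)
    : Prop :=
  inU F a /\ inL F x /\ inU F b /\ inL F y /\ (x ∘ b ≲ a ∘ y).

Lemma vsq_exists (X Y Z : S) (a : S X Z) (x : S Y Z) :
  inU F a -> inL F x -> exists (P : S) (b : S P Y) (y : S P X), vsq a x b y.
Proof.
move=> Ua Lx; have [P [b [y [Ub [Ly h]]]]] := V2_exists hS Ua Lx.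
by exists P, b, y; do !(split=> //).
Qed.

(** Composing the first square with [i] and [j] gives a V2 square on the second cospan, where the
    uniqueness in V2 applies. *)
Lemma vsq_unique (X Y Z P X1 Y1 Z1 P1 : S) (a : S X Z) (x : S Y Z) (b : S P Y)
    (y : S P X) (a1 : S X1 Z1) (x1 : S Y1 Z1) (b1 : S P1 Y1) (y1 : S P1 X1)
    (i : S X X1) (j : S Y Y1) (l : S Z Z1) :
  is_equiv i -> is_equiv j ->
  a1 ∘ i ≃ l ∘ a -> x1 ∘ j ≃ l ∘ x ->
  vsq a x b y -> vsq a1 x1 b1 y1 ->
  exists h : S P P1, is_equiv h /\ (b1 ∘ h ≃ j ∘ b) /\ (y1 ∘ h ≃ i ∘ y).
Proof.
move=> hi hj ea ex [Ua [Lx [Ub [Ly h]]]] [Ua1 [Lx1 [Ub1 [Ly1 h1]]]].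
apply: (V2_unique hS Ua1 Lx1) => //.
- exact: inU_comp (inU_equiv hj) Ub.
- exact: inL_comp (inL_equiv hi) Ly.
- by change (x1 ∘ (j ∘ b) ≲ a1 ∘ (i ∘ y));
    rewrite (comp1_iso_pre ex) (comp1_iso_pre ea) h.
Qed.

Lemma bipb_unique_along (A B C P A1 B1 C1 P1 : S) (f : S A C) (g : S B C)
    (p : S P A) (q : S P B) (f1 : S A1 C1) (g1 : S B1 C1) (p1 : S P1 A1)
    (q1 : S P1 B1) (i : S A A1) (j : S B B1) (l : S C C1) :
  is_equiv i -> is_equiv j -> is_equiv l ->
  f1 ∘ i ≃ l ∘ f -> g1 ∘ j ≃ l ∘ g ->
  bipb f g p q -> bipb f1 g1 p1 q1 ->
  exists h : S P P1, is_equiv h /\ (p1 ∘ h ≃ i ∘ p) /\ (q1 ∘ h ≃ j ∘ q).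
Proof.
move=> hi hj hl ef eg b; apply: (bipb_unique pre).
exact: bipb_transport ef eg b.
Qed.

Lemma bipb_L (A B C : S) (f : S A C) (g : S B C) : inL F f -> inL F g ->
  (exists (P : S) (p : S P A) (q : S P B), bipb f g p q) /\
  (forall (P : S) (p : S P A) (q : S P B), bipb f g p q -> inL F p /\ inL F q).
Proof.
move=> Lf Lg; have [[P [p [q h]]] proj] := V1_L hS Lf Lg; split.
- by exists P, p, q; apply/(bipullback_squareP pre).
- by move=> P' p' q' /(bipullback_squareP pre); apply: proj.
Qed.

Lemma bipb_U (A B C : S) (f : S A C) (g : S B C) : inU F f -> inU F g ->
  (exists (P : S) (p : S P A) (q : S P B), bipb f g p q) /\
  (forall (P : S) (p : S P A) (q : S P B), bipb f g p q -> inU F p /\ inU F q).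
Proof.
move=> Uf Ug; have [[P [p [q h]]] proj] := V1_U hS Uf Ug; split.
- by exists P, p, q; apply/(bipullback_squareP pre).
- by move=> P' p' q' /(bipullback_squareP pre); apply: proj.
Qed.

(** * Grids computing fake pullbacks *)

(** Four cells: the bipullback of [x] and [y], a V2 square on either side of it, and a bipullback at
    the opposite corner [Q]. The outer edges [u] and [v] are matched only up to isomorphism, which
    makes the notion stable under isomorphism of spans. *)
Definition grid (U V W R T Q : S) (x : S R W) (a : S U R) (y : S T W) (b : S V T)
    (u : S Q U) (v : S Q V) : Prop :=
  exists (Z : S) (y1 : S Z R) (x1 : S Z T)
         (X : S) (a1 : S X Z) (y2 : S X U)
         (Y : S) (b1 : S Y Z) (x2 : S Y V)
         (b2 : S Q X) (a2 : S Q Y),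
    bipb x y y1 x1 /\ vsq a y1 a1 y2 /\ vsq b x1 b1 x2 /\ bipb a1 b1 b2 a2 /\
    (u ≃ y2 ∘ b2) /\ (v ≃ x2 ∘ a2).

Lemma grid_exists (U V W R T : S) (x : S R W) (a : S U R) (y : S T W) (b : S V T) :
  inL F x -> inU F a -> inL F y -> inU F b ->
  exists (Q : S) (u : S Q U) (v : S Q V), grid x a y b u v.
Proof.
move=> Lx Ua Ly Ub.
have [[Z [y1 [x1 h1]]] proj] := bipb_L Lx Ly; have [Ly1 Lx1] := proj _ _ _ h1.
have [X [a1 [y2 h2]]] := vsq_exists Ua Ly1.
have [Y [b1 [x2 h3]]] := vsq_exists Ub Lx1.
have [[Q [b2 [a2 h4]]] _] :=
  bipb_U (proj1 (proj2 (proj2 h2))) (proj1 (proj2 (proj2 h3))).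
exists Q, (y2 ∘ b2), (x2 ∘ a2), Z, y1, x1, X, a1, y2, Y, b1, x2, b2, a2.
by do !(split=> //).
Qed.

Lemma grid_sym (U V W R T Q : S) (x : S R W) (a : S U R) (y : S T W) (b : S V T)
    (u : S Q U) (v : S Q V) : grid x a y b u v -> grid y b x a v u.
Proof.
case=> Z [y1 [x1 [X [a1 [y2 [Y [b1 [x2 [b2 [a2 [h1 [h2 [h3 [h4 [eu ev]]]]]]]]]]]]]]].
exists Z, x1, y1, Y, b1, x2, X, a1, y2, a2, b2.
split; first exact: bipb_sym.
by do 2!split=> //; split; first exact: bipb_sym.
Qed.

(** Comparison equivalences are built cell by cell, at [Z], then at [X] and [Y], then at [Q]; the
    compatibility of each with the edges of its cell is the input for the next cell. *)
Lemma grid_unique (U V W R T Q R1 T1 Q1 : S) (x : S R W) (a : S U R) (y : S T W)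
    (b : S V T) (u : S Q U) (v : S Q V) (x' : S R1 W) (a' : S U R1) (y' : S T1 W)
    (b' : S V T1) (u' : S Q1 U) (v' : S Q1 V) (i : S R R1) (j : S T T1) :
  is_equiv i -> is_equiv j ->
  i ∘ a ≃ a' -> x' ∘ i ≃ x -> j ∘ b ≃ b' -> y' ∘ j ≃ y ->
  grid x a y b u v -> grid x' a' y' b' u' v' ->
  span_iso (Span u v) (Span u' v').
Proof.
move=> hi hj ia xi jb yj.
case=> Z [y1 [x1 [X [a1 [y2 [Y [b1 [x2 [b2 [a2 [h1 [h2 [h3 [h4 [eu ev]]]]]]]]]]]]]]].
case=> Z' [y1' [x1' [X' [a1' [y2' [Y' [b1' [x2' [b2' [a2'
  [h1' [h2' [h3' [h4' [eu' ev']]]]]]]]]]]]]]].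
have [||z [hz [yz xz]]] :=
  bipb_unique_along hi hj (is_equiv_id W) _ _ h1 h1'.
  by rewrite xi comp1_1l.
  by rewrite yj comp1_1l.
have [||k [hk [ak yk]]] := vsq_unique (l := i) (is_equiv_id U) hz _ _ h2 h2'.
  by rewrite comp1_1r ia.
  by rewrite yz.
have [||l [hl [bl xl]]] := vsq_unique (l := j) (is_equiv_id V) hz _ _ h3 h3'.
  by rewrite comp1_1r jb.
  by rewrite xz.
have [h [hh [bh ah]]] := bipb_unique_along hk hl hz ak bl h4 h4'.
rewrite !comp1_1l in yk xl.
exists h; split=> //; split.
- by change (u' ∘ h ≃ u); rewrite eu eu' comp1A bh -comp1A yk.
- by change (v' ∘ h ≃ v); rewrite ev ev' comp1A ah -comp1A xl.
Qed.

(** * Fake pullbacks: existence, uniqueness, invariance *)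

(** Working form of [is_fake_pullback], with separate legs; closure under isomorphism of spans is
    already part of [grid]. *)
Definition fake (U V W Q : S) (r : S U W) (s : S V W) (u : S Q U) (v : S Q V)
    : Prop :=
  exists (R : S) (x : S R W) (a : S U R) (T : S) (y : S T W) (b : S V T),
    factors r x a /\ factors s y b /\ grid x a y b u v.

Lemma span_iso_sym (X Y : S) (s t : span X Y) : span_iso s t -> span_iso t s.
Proof.
move=> [h [hh [el er]]]; have [h' [h'h [hh' eh']]] := is_equivE hh.
exists h'; split=> //; split.
- by change (leg_l s ∘ h' ≃ leg_l t); rewrite -(el : _ ≃ _) comp1A hh' comp1_1r.
- by change (leg_r s ∘ h' ≃ leg_r t); rewrite -(er : _ ≃ _) comp1A hh' comp1_1r.
Qed.

Lemma span_iso_trans (X Y : S) (s t w : span X Y) :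
  span_iso s t -> span_iso t w -> span_iso s w.
Proof.
move=> [h [hh [el er]]] [k [hk [fl fr]]].
exists (k ∘ h); split; first exact: is_equiv_comp.
split.
- by change (leg_l w ∘ (k ∘ h) ≃ leg_l s);
    rewrite -comp1A (fl : _ ≃ _) (el : _ ≃ _).
- by change (leg_r w ∘ (k ∘ h) ≃ leg_r s);
    rewrite -comp1A (fr : _ ≃ _) (er : _ ≃ _).
Qed.

Lemma grid_iso (U V W R T Q Q1 : S) (x : S R W) (a : S U R) (y : S T W)
    (b : S V T) (u : S Q U) (v : S Q V) (u' : S Q1 U) (v' : S Q1 V) :
  span_iso (Span u' v') (Span u v) -> grid x a y b u v -> grid x a y b u' v'.
Proof.
move=> [h [hh [eu' ev']]].
case=> Z [y1 [x1 [X [a1 [y2 [Y [b1 [x2 [b2 [a2 [h1 [h2 [h3 [h4 [eu ev]]]]]]]]]]]]]]].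
exists Z, y1, x1, X, a1, y2, Y, b1, x2, (b2 ∘ h), (a2 ∘ h).
do 3!split=> //; split; first exact: bipb_apex.
by rewrite -!comp1A -eu -ev; split; symmetry.
Qed.

Lemma is_fake_pullbackP (U V W Q : S) (r : S U W) (s : S V W) (u : S Q U)
    (v : S Q V) :
  is_fake_pullback F r s (Span u v) <-> fake r s u v.
Proof.
split.
- case=> _ [[R [a [x [T [b [y [Z [y' [x' [X [abar [ybar [Y [bbar [xbar [Q' [b' [a'
    [hr [hs [h1 [h2 [h3 [h4 ->]]]]]]]]]]]]]]]]]]]]]]]] e].
  exists R, x, a, T, y, b; split=> //; split=> //; apply: (grid_iso e).
  move/(bipullback_squareP pre): h1 => h1; move/(bipullback_squareP pre): h4 => h4.
  (* [vsq] records that the projections lie in the right class, which the construction leaves to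
     V1. *)
  have [Ly' Lx'] := proj2 (bipb_L (proj1 (proj2 hr)) (proj1 (proj2 hs))) _ _ _ h1.
  case: hr hs h2 h3 => [Ua _] [Ub _] [? [? ?]] [? [? ?]].
  exists Z, y', x', X, abar, ybar, Y, bbar, xbar, b', a'.
  by [].
- case=> R [x [a [T [y [b [hr [hs]]]]]]].
  case=> Z [y1 [x1 [X [a1 [y2 [Y [b1 [x2 [b2 [a2
    [h1 [h2 [h3 [h4 [eu ev]]]]]]]]]]]]]]].
  exists (Span (y2 ∘ b2) (x2 ∘ a2)); split.
  + exists R, a, x, T, b, y, Z, y1, x1, X, a1, y2, Y, b1, x2, Q, b2, a2.
    case: h2 h3 => [_ [_ h2]] [_ [_ h3]].
    by do !(split; [by [] || exact/(bipullback_squareP pre) |]).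
  + exists (id1 Q); split; first exact: is_equiv_id.
    by split; [change (y2 ∘ b2 ∘ id1 Q ≃ u) | change (x2 ∘ a2 ∘ id1 Q ≃ v)];
      rewrite comp1_1r ?eu ?ev.
Qed.

Lemma fake_exists (U V W : S) (r : S U W) (s : S V W) :
  exists (Q : S) (u : S Q U) (v : S Q V), fake r s u v.
Proof.
have [R [x [a hr]]] := factors_exists r; have [T [y [b hs]]] := factors_exists s.
case: (hr) (hs) => [Ua [Lx _]] [Ub [Ly _]].
have [Q [u [v h]]] := grid_exists Lx Ua Ly Ub.
by exists Q, u, v, R, x, a, T, y, b.
Qed.

Lemma fake_unique (U V W Q Q' : S) (r : S U W) (s : S V W) (u : S Q U) (v : S Q V)
    (u' : S Q' U) (v' : S Q' V) :
  fake r s u v -> fake r s u' v' -> span_iso (Span u v) (Span u' v').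
Proof.
move=> [R [x [a [T [y [b [hr [hs g]]]]]]]] [R' [x' [a' [T' [y' [b' [hr' [hs' g']]]]]]]].
have [i [hi [ia xi]]] := factors_unique hr hr'.
have [j [hj [jb yj]]] := factors_unique hs hs'.
exact: grid_unique hi hj ia xi jb yj g g'.
Qed.

(** The factorizations may be prescribed: they carry some grid, and uniqueness identifies its span
    with the given one. *)
Lemma fake_grid (U V W R T Q : S) (r : S U W) (s : S V W) (x : S R W) (a : S U R)
    (y : S T W) (b : S V T) (u : S Q U) (v : S Q V) :
  factors r x a -> factors s y b -> fake r s u v -> grid x a y b u v.
Proof.
move=> hr hs h; case: (hr) (hs) => [Ua [Lx _]] [Ub [Ly _]].
have [Q' [u' [v' h']]] := grid_exists Lx Ua Ly Ub.
apply: (grid_iso _ h'); apply: (fake_unique h).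
by exists R, x, a, T, y, b; split=> //; split=> //.
Qed.

Lemma fake_sym (U V W Q : S) (r : S U W) (s : S V W) (u : S Q U) (v : S Q V) :
  fake r s u v -> fake s r v u.
Proof.
case=> R [x [a [T [y [b [hr [hs h]]]]]]].
by exists T, y, b, R, x, a; split=> //; split=> //; apply: grid_sym.
Qed.

(** With the identity factored into identities, every cell of the grid has a pair of opposite
    identity sides. *)
Lemma fake_id (U W : S) (r : S U W) : fake r (id1 W) (id1 U) r.
Proof.
have [R [x [a hr]]] := factors_exists r; case: (hr) => [Ua [Lx e]].
have U1 V : inU F (id1 V) := inU_equiv (is_equiv_id V).
have L1 V : inL F (id1 V) := inL_equiv (is_equiv_id V).
exists R, x, a, W, (id1 W), (id1 W).
split=> //; split; first by split; [|split; [|rewrite comp1_1l]].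
exists R, (id1 R), x, U, a, (id1 U), R, (id1 R), x, (id1 U), a.
split; first exact: bipb_id.
split; first by do 4!(split=> //); rewrite comp1_1l comp1_1r.
split; first by do 4!(split=> //); rewrite comp1_1l comp1_1r.
split; first exact: bipb_id.
by rewrite comp1_1l.
Qed.

(** Only the V2 square on [a] changes: a quasi-inverse of [h] is absorbed into [a], and [h] into
    [y2]. *)
Lemma fake_transport_l (U U1 V W Q : S) (r : S U W) (s : S V W) (u : S Q U)
    (v : S Q V) (r1 : S U1 W) (h : S U U1) :
  is_equiv h -> r1 ∘ h ≃ r -> fake r s u v -> fake r1 s (h ∘ u) v.
Proof.
move=> hh rh [R [x [a [T [y [b [[Ua [Lx e]] [hs g]]]]]]]].
have [k [kh [hk ek]]] := is_equivE hh.
exists R, x, (a ∘ k), T, y, b; split.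
  split; first exact: inU_comp Ua (inU_equiv ek).
  by split=> //; rewrite -comp1A -e -rh comp1A hk comp1_1r.
split=> //.
case: g => Z [y1 [x1 [X [a1 [y2 [Y [b1 [x2 [b2 [a2
  [h1 [[_ [Ly1 [Ua1 [Ly2 h2]]]] [h3 [h4 [eu ev]]]]]]]]]]]]]]].
exists Z, y1, x1, X, a1, (h ∘ y2), Y, b1, x2, b2, a2.
split=> //; split.
  split; first exact: inU_comp Ua (inU_equiv ek).
  split=> //; split=> //; split; first exact: inL_comp (inL_equiv hh) Ly2.
  by rewrite comp1A (comp1_inv kh).
by do 2!split=> //; rewrite eu comp1A.
Qed.

Lemma fake_transport (U U1 V V1 W Q : S) (r : S U W) (s : S V W) (u : S Q U)
    (v : S Q V) (r1 : S U1 W) (s1 : S V1 W) (h : S U U1) (k : S V V1) :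
  is_equiv h -> is_equiv k -> r1 ∘ h ≃ r -> s1 ∘ k ≃ s ->
  fake r s u v -> fake r1 s1 (h ∘ u) (k ∘ v).
Proof.
move=> hh hk rh sk /(fake_transport_l hh rh) /fake_sym.
by move/(fake_transport_l hk sk)/fake_sym.
Qed.

(** * Pasting of fake pullbacks *)

Lemma fake_paste (U V V' W Q Q' : S) (r : S U W) (s : S V W) (s' : S V' V)
    (u : S Q U) (v : S Q V) (u' : S Q' Q) (v' : S Q' V') :
  fake r s u v -> fake v s' u' v' -> fake r (s ∘ s') (u ∘ u') v'.
Proof.
case=> R [x [a [T [y [b [hr [[Ub [Ly es]]]]]]]]].
case=> Z [y1 [x1 [X [a1 [y2 [Y [b1 [x2 [b2 [a2 [h1 [h2 [h3 [h4 [eu ev]]]]]]]]]]]]]]].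
case: (hr) => [Ua [Lx er]].
case: h2 => [_ [Ly1 [Ua1 [Ly2 h2]]]]; case: h3 => [_ [Lx1 [Ub1 [Lx2 h3]]]].
have [Ub2 Ua2] := proj2 (bipb_U Ua1 Ub1) _ _ _ h4.
have [T' [y' [b' hs']]] := factors_exists s'; case: (hs') => [Ub' [Ly' es']].
(* The first grid already factors [v]; computing the second fake pullback from this factorization
   makes the two grids share the edges [x2] and [a2]. *)
have fv : factors v x2 a2 by [].
move/(fake_grid fv hs').
case=> Z' [y1' [x3 [X' [a3 [y2' [Y' [b1' [x4 [b2' [a4
  [k1 [k2 [k3 [k4 [eu' ev']]]]]]]]]]]]]]].
case: k2 => [_ [Ly1' [Ua3 [Ly2' k2]]]]; case: k3 => [_ [Lx3 [Ub1' [Lx4 k3]]]].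
have [Ub2' Ua4] := proj2 (bipb_U Ua3 Ub1') _ _ _ k4.
have [J [w [d [Ud [Lw ewd]]]]] := factors_exists (b ∘ y').
have [I [n [c [Uc [Ln enc]]]]] := factors_exists (b1 ∘ y1').
have [K [p [k [Uk [Lp epk]]]]] := factors_exists (b2 ∘ y2').
(* V3 swaps the columns b and y' in the row of x, V4 in the row of a. *)
have [q [Lq [qc /(bipullback_squareP pre) bq]]] := V3 hS Ly1' Ly' Lx3 Lx2 Lx1 Ub1 Ub
  (proj2 (bipullback_squareP pre _ _ _ _) k1) h3 Uc Ln enc Ud Lw ewd.
have [j [Uj [/(bipullback_squareP pre) bj nj]]] := V4 hS Ly1' Ly2' Ub2 Ub1 Ua3 Ua2 Ua1
  k2 (proj2 (bipullback_squareP pre _ _ _ _) h4) Uk Lp epk Uc Ln enc.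
have ule : q ∘ c ≲ d ∘ x3 := qc.
have nle : n ∘ j ≲ a1 ∘ p := nj.
(* After the swap [w] joins [y] and [d] joins [b'], which factors [s ∘ s']. *)
exists R, x, a, J, (y ∘ w), (d ∘ b'); split=> //; split.
  split; first exact: inU_comp.
  split; first exact: inL_comp.
  by rewrite es es' !comp1A (comp1_iso_pre (ewd : b ∘ y' ≃ w ∘ d)).
(* The bipullbacks [bq] and [bj] paste with the outer bipullbacks of the two grids, while the
   2-cells [nle] and [ule] compose with the remaining V2 squares. *)
exists I, (y1 ∘ n), q, K, j, (y2 ∘ p), Y', (c ∘ b1'), x4, (k ∘ b2'), a4.
split; first exact: bipb_paste h1 bq.
split.
  split=> //; split; first exact: inL_comp.
  split=> //; split; first exact: inL_comp.
  by rewrite comp1A nle -!comp1A h2.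
split.
  split; first exact: inU_comp.
  split=> //; split; first exact: inU_comp.
  by split=> //; rewrite -comp1A ule !comp1A k3.
split; first exact: bipb_paste bj k4.
by split=> //; rewrite eu eu' !comp1A (comp1_iso_pre (epk : b2 ∘ y2' ≃ p ∘ k)).
Qed.

(** * Composition of isomorphism classes of spans *)

(** Well-definedness of composition: the first fake pullback is transported to the cospan of [s']
    and [t'], where it agrees with the second by uniqueness. *)
Lemma composite_span_iso (X Y Z : S) (s s' : span X Y) (t t' : span Y Z)
    (fp : span (apex s) (apex t)) (fp' : span (apex s') (apex t')) :
  span_iso s s' -> span_iso t t' ->
  is_fake_pullback F (leg_r s) (leg_l t) fp ->
  is_fake_pullback F (leg_r s') (leg_l t') fp' ->
  span_iso (span_comp_along fp) (span_comp_along fp').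
Proof.
move=> [h [hh [pl pr]]] [k [hk [ql qr]]].
case: fp fp' => [Q u v] [Q' u' v'] /is_fake_pullbackP f /is_fake_pullbackP f'.
have [m [hm [um vm]]] := fake_unique (fake_transport hh hk pr ql f) f'.
exists m; split=> //; split.
- by change (leg_l s' ∘ u' ∘ m ≃ leg_l s ∘ u);
    rewrite comp1A (um : u' ∘ m ≃ h ∘ u) -comp1A (pl : _ ≃ _).
- by change (leg_r t' ∘ v' ∘ m ≃ leg_r t ∘ v);
    rewrite comp1A (vm : v' ∘ m ≃ k ∘ v) -comp1A (qr : _ ≃ _).
Qed.

Lemma span_iso_legs (X Y Q : S) (u u' : S Q X) (v v' : S Q Y) :
  u ≃ u' -> v ≃ v' -> span_iso (Span u v) (Span u' v').
Proof.
move=> eu ev; exists (id1 Q); split; first exact: is_equiv_id.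
by split; [change (u' ∘ id1 Q ≃ u) | change (v' ∘ id1 Q ≃ v)];
  rewrite comp1_1r ?eu ?ev.
Qed.

Lemma span_iso_refl (X Y : S) (s : span X Y) : span_iso s s.
Proof. by case: s => Q u v; apply: span_iso_legs. Qed.

Lemma span_iso_ext (X Y : S) (s t : span X Y) :
  span_iso s t -> span_iso s = span_iso t.
Proof.
move=> st; apply: functional_extensionality => w.
apply: propositional_extensionality; split.
  exact: span_iso_trans (span_iso_sym st).
exact: span_iso_trans.
Qed.

Lemma span_class_eq (X Y : S) (c d : span_class X Y) :
  proj1_sig c = proj1_sig d -> c = d.
Proof.
by case: c d => [c hc] [d hd] /= e; subst d; rewrite (proof_irrelevance _ hc hd).
Qed.

Lemma class_of_eq (X Y : S) (s t : span X Y) :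
  span_iso s t -> class_of s = class_of t.
Proof. by move=> st; apply: span_class_eq; apply: span_iso_ext. Qed.

Lemma class_of_inj (X Y : S) (s t : span X Y) :
  class_of s = class_of t -> span_iso s t.
Proof. by move/(f_equal (@proj1_sig _ _)) => /= ->; apply: span_iso_refl. Qed.

Lemma class_of_surj (X Y : S) (c : span_class X Y) : exists s, c = class_of s.
Proof. by case: (c) => d [s e]; exists s; apply: span_class_eq. Qed.

(** Ranging over all representatives and all fake pullbacks avoids choosing any; by
    [composite_span_iso] the result is a single class. *)
Definition composite (X Y Z : S) (c : span_class Y Z) (d : span_class X Y) :
  span X Z -> Prop :=
  fun w => exists (s : span X Y) (t : span Y Z) (fp : span (apex s) (apex t)),
    d = class_of s /\ c = class_of t /\
    is_fake_pullback F (leg_r s) (leg_l t) fp /\ span_iso (span_comp_along fp) w.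

Lemma composite_class_of (X Y Z : S) (s : span X Y) (t : span Y Z)
    (fp : span (apex s) (apex t)) :
  is_fake_pullback F (leg_r s) (leg_l t) fp ->
  composite (class_of t) (class_of s) = span_iso (span_comp_along fp).
Proof.
move=> f; apply: functional_extensionality => w.
apply: propositional_extensionality; split; last by exists s, t, fp.
case=> s' [t' [fp' [/class_of_inj es [/class_of_inj et [f' e]]]]].
exact: span_iso_trans (composite_span_iso es et f f') e.
Qed.

Lemma fake_pullback_exists (U V W : S) (r : S U W) (s : S V W) :
  exists fp : span U V, is_fake_pullback F r s fp.
Proof.
have [Q [u [v f]]] := fake_exists r s.
by exists (Span u v); apply/is_fake_pullbackP.
Qed.

Lemma composite_is_class (X Y Z : S) (c : span_class Y Z) (d : span_class X Y) :
  exists w, composite c d = span_iso w.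
Proof.
have [t ->] := class_of_surj c; have [s ->] := class_of_surj d.
have [fp f] := fake_pullback_exists (leg_r s) (leg_l t).
by exists (span_comp_along fp); apply: composite_class_of.
Qed.

Definition class_comp_spn (X Y Z : S) (c : span_class Y Z) (d : span_class X Y) :
  span_class X Z := exist _ (composite c d) (composite_is_class c d).

Lemma class_comp_spnE (X Y Z : S) (s : span X Y) (t : span Y Z)
    (fp : span (apex s) (apex t)) :
  is_fake_pullback F (leg_r s) (leg_l t) fp ->
  class_comp_spn (class_of t) (class_of s) = class_of (span_comp_along fp).
Proof. by move=> f; apply: span_class_eq; apply: composite_class_of. Qed.

(** * Identity and associativity laws *)

Definition class_id (X : S) : span_class X X := class_of (Span (id1 X) (id1 X)).

Lemma class_comp_id_l (X Y : S) (c : span_class X Y) :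
  class_comp_spn (class_id Y) c = c.
Proof.
have [[Q p q] ->] := class_of_surj c.
have f : is_fake_pullback F q (id1 Y) (Span (id1 Q) q).
  exact/is_fake_pullbackP/fake_id.
rewrite (class_comp_spnE (s := Span p q) (t := Span (id1 Y) (id1 Y)) f).
by apply: class_of_eq; apply: span_iso_legs; rewrite /= ?comp1_1r ?comp1_1l.
Qed.

Lemma class_comp_id_r (X Y : S) (c : span_class X Y) :
  class_comp_spn c (class_id X) = c.
Proof.
have [[Q p q] ->] := class_of_surj c.
have f : is_fake_pullback F (id1 X) p (Span p (id1 Q)).
  exact/is_fake_pullbackP/fake_sym/fake_id.
rewrite (class_comp_spnE (s := Span (id1 X) (id1 X)) (t := Span p q) f).
by apply: class_of_eq; apply: span_iso_legs; rewrite /= ?comp1_1r ?comp1_1l.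
Qed.

Lemma class_comp_assoc (W X Y Z : S) (c : span_class Y Z) (d : span_class X Y)
    (e : span_class W X) :
  class_comp_spn (class_comp_spn c d) e = class_comp_spn c (class_comp_spn d e).
Proof.
have [[C p'' q''] ->] := class_of_surj c.
have [[B p' q'] ->] := class_of_surj d; have [[A p q] ->] := class_of_surj e.
have [M [u [v f]]] := fake_exists q p'.
have [N [u' [v' f']]] := fake_exists q' p''.
(* [O] serves as apex for both bracketings: pasting on one side, and on the other by symmetry, gives
   composite spans whose legs differ only by associativity. *)
have [O [w [w' g]]] := fake_exists v u'.
have /is_fake_pullbackP hl := fake_paste f g.
have /is_fake_pullbackP hr := fake_sym (fake_paste (fake_sym f') (fake_sym g)).
move/is_fake_pullbackP: f => f; move/is_fake_pullbackP: f' => f'.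
rewrite (class_comp_spnE (s := Span p q) (t := Span p' q') f).
rewrite (class_comp_spnE (s := Span p' q') (t := Span p'' q'') f') /=.
rewrite (class_comp_spnE (s := Span p q) (t := Span (p' ∘ u') (q'' ∘ v')) hl).
rewrite (class_comp_spnE (s := Span (p ∘ u) (q' ∘ v)) (t := Span p'' q'') hr).
by apply: class_of_eq; apply: span_iso_legs; rewrite /= !comp1A.
Qed.

End FakePullback.

Theorem theorem13 (S : bicategory) (F : factorization_system S)
    (hS : fake_pullback_ready F) :
  exists Spn : @category_on (bob S) (@span_class S),
    forall (X Y Z : S) (s : span X Y) (t : span Y Z),
      (exists fp : span (apex s) (apex t),
         is_fake_pullback F (leg_r s) (leg_l t) fp) /\
      (forall fp : span (apex s) (apex t),
         is_fake_pullback F (leg_r s) (leg_l t) fp ->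
         compm Spn (class_of t) (class_of s) = class_of (span_comp_along fp)).
Proof.
exists (CategoryOn (class_comp_id_l hS) (class_comp_id_r hS) (class_comp_assoc hS)).
move=> X Y Z s t; split; first exact: fake_pullback_exists hS _ _ _ _ _.
exact: class_comp_spnE.
Qed.
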